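(* Let $G=(V,E)$ be a simple graph and let $e=\{u,v\}\in E$ be an edge with $N[v]=N[u]$. If there exists a support vertex $w\in N[u]$, then the edge $e$ is an irrelevant edge of $G$, i.e. $D_t(G,x)=D_t(G\setminus e,x)$.
   Context: For a simple graph $G=(V,E)$, $N(v)$ is the set of neighbors of $v$ and $N[v]=N(v)\cup\{v\}$. A leaf is a vertex of degree one; a support vertex is a vertex adjacent to a leaf. A set $D\subseteq V$ is a total dominating set if every vertex of $V$ is adjacent to some vertex of $D$. $d_t(G,i)$ is the number of total dominating sets of $G$ of cardinality $i$, and $D_t(G,x)=\sum_i d_t(G,i)x^i$ is the total domination polynomial of $G$. $G\setminus e$ denotes $G$ with the edge $e$ deleted (vertices kept). An edge $e$ of $G$ is called irrelevant if $D_t(G,x)=D_t(G\setminus e,x)$.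
   Formalization: The formal theorem adds N[u] ≠ {u,v}, i.e. e is not a K_2 component of G; without it the claim fails for G = K_2, where u is a support vertex, D_t(G,x) = x^2 and D_t(G∖e,x) = 0. *)

(* Defs.v *)
From mathcomp Require Import all_boot all_order all_algebra.

Set Implicit Arguments.
Unset Strict Implicit.
Unset Printing Implicit Defensive.

Import GRing.Theory.
Local Open Scope ring_scope.

Record sgraph (T : finType) := SGraph {
  adj :> rel T;
  adj_sym : symmetric adj;
  adj_irrefl : irreflexive adj
}.

Section Graph.
Variables (T : finType) (G : sgraph T).

Definition edges : {set {set T}} :=
  [set [set p.1; p.2] | p : T * T & G p.1 p.2].

Definition nbhd (x : T) : {set T} := [set y | G x y].

Definition closed_nbhd (x : T) : {set T} := x |: nbhd x.

Definition leaf (x : T) : bool := #|nbhd x| == 1%N.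

Definition support_vertex (x : T) : bool := [exists y, G x y && leaf y].

Definition total_dominating (D : {set T}) : bool :=
  [forall x, [exists y in D, G x y]].

Definition num_tds (i : nat) : nat :=
  #|[set D : {set T} | total_dominating D & #|D| == i]|.

Definition tdom_poly : {poly int} :=
  \sum_(i < #|T|.+1) (num_tds i)%:R *: 'X^i.

Definition del_adj (e : {set T}) : rel T :=
  [rel x y | G x y && ([set x; y] != e)].

Lemma del_adj_sym (e : {set T}) : symmetric (del_adj e).
Proof. by move=> x y; rewrite /del_adj /= (adj_sym G x) setUC. Qed.

Lemma del_adj_irrefl (e : {set T}) : irreflexive (del_adj e).
Proof. by move=> x; rewrite /del_adj /= (adj_irrefl G). Qed.

Definition del_edge (e : {set T}) : sgraph T :=
  SGraph (del_adj_sym e) (del_adj_irrefl e).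

End Graph.

Definition irrelevant_edge (T : finType) (G : sgraph T) (e : {set T}) : Prop :=
  e \in edges G /\ tdom_poly G = tdom_poly (del_edge G e).

(* Main.v *)
Require Import Defs.
From mathcomp Require Import all_boot all_order all_algebra.

(* A support vertex w in N[u] = N[v] other than u and v is adjacent to both and
   lies in every total dominating set (its leaf has no other neighbor), so it
   dominates u and v without e, while no other vertex uses e. If instead the
   support vertex is u or v, its leaf has to be the other end of e, and then e is
   a component K_2. *)

Set Implicit Arguments.
Unset Strict Implicit.
Unset Printing Implicit Defensive.

Section Graph.
Variables (T : finType) (G : sgraph T).

Lemma edgesE (u v : T) : ([set u; v] \in edges G) = G u v.
Proof.
apply/imsetP/idP => [[[x y] /= Gxy e_xy]|Guv]; last by exists (u, v); rewrite ?inE.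
rewrite inE /= in Gxy.
(* This excludes the two cases below where [x] and [y] are the same end of the edge. *)
have xNy : x != y by apply: contraTneq Gxy => ->; rewrite (adj_irrefl G).
have: x \in [set u; v] by rewrite e_xy set21.
have: y \in [set u; v] by rewrite e_xy set22.
rewrite !inE => /orP[] /eqP ey /orP[] /eqP ex; subst x y => //.
- by rewrite eqxx in xNy.
- by rewrite adj_sym.
- by rewrite eqxx in xNy.
Qed.

Lemma in_closed_nbhd (x y : T) : (y \in closed_nbhd G x) = (y == x) || G x y.
Proof. by rewrite !inE. Qed.

Lemma leaf_nbhd (x y : T) : leaf G y -> G x y -> nbhd G y = [set x].
Proof.
move=> /cards1P[z Ny] Gxy.
have: x \in nbhd G y by rewrite inE adj_sym.
by rewrite Ny inE => /eqP ->.
Qed.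

(** The leaf [y] at [u] lies in N[v] and has [u] as its only neighbor. Adjacency to [v] would force
    v = u, so y = v and [v] is itself a leaf. *)
Lemma twin_support_K2 (u v : T) :
  G u v -> closed_nbhd G v = closed_nbhd G u -> support_vertex G u ->
  closed_nbhd G u = [set u; v].
Proof.
move=> Guv eqN /existsP[y /andP[Guy leaf_y]].
have Ny := leaf_nbhd leaf_y Guy.
have : y \in closed_nbhd G v by rewrite eqN in_closed_nbhd Guy orbT.
rewrite in_closed_nbhd => /orP[/eqP yv | Gvy].
  by rewrite -eqN /closed_nbhd -yv Ny setUC.
have : v \in nbhd G y by rewrite inE adj_sym.
by rewrite Ny inE => /eqP vu; rewrite vu adj_irrefl in Guv.
Qed.

Lemma support_vertex_tds (w : T) (D : {set T}) :
  support_vertex G w -> total_dominating G D -> w \in D.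
Proof.
move=> /existsP[y /andP[Gwy leaf_y]] /forallP/(_ y)/existsP[z /andP[zD Gyz]].
have : z \in nbhd G y by rewrite inE.
by rewrite (leaf_nbhd leaf_y Gwy) inE => /eqP <-.
Qed.

Lemma total_dominating_del_edge (e D : {set T}) :
  total_dominating (del_edge G e) D -> total_dominating G D.
Proof.
move=> /forallP domD; apply/forallP => x.
have /existsP[y /and3P[yD Gxy _]] := domD x.
by apply/existsP; exists y; rewrite yD.
Qed.

(** The coefficients only count total dominating sets by size, so comparing the sets suffices. *)
Lemma eq_tdom_poly (H : sgraph T) :
  total_dominating G =1 total_dominating H -> tdom_poly G = tdom_poly H.
Proof.
move=> eqGH; apply: eq_bigr => i _; congr (_%:R *: _)%R.
by apply: eq_card => D; rewrite !inE eqGH.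
Qed.

End Graph.

(* The hypothesis [not_K2] says that e is not a connected component K_2 of G.
   It cannot be dropped: for G = K_2 the vertex u is itself a support vertex of
   N[u], and D_t(K_2,x) = x^2 while D_t(K_2 \ e,x) = 0. *)
Theorem theorem2p5 (T : finType) (G : sgraph T) (u v : T)
    (uv_edge : [set u; v] \in edges G)
    (eq_nbhd : closed_nbhd G v = closed_nbhd G u)
    (not_K2 : closed_nbhd G u <> [set u; v])
    (has_support : exists w : T, w \in closed_nbhd G u /\ support_vertex G w) :
  irrelevant_edge G [set u; v].
Proof.
split=> //; apply: eq_tdom_poly => D; apply/idP/idP; last first.
  exact: total_dominating_del_edge.
move=> domD; rewrite edgesE in uv_edge.
case: has_support => w [wNu supp_w].
have wu : w != u.
  apply/eqP => wu; apply: not_K2; apply: twin_support_K2 => //.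
  by rewrite -wu.
have wv : w != v.
  apply/eqP => wv; apply: not_K2; rewrite -eq_nbhd setUC.
  by apply: twin_support_K2; [rewrite adj_sym | | rewrite -wv].
have Guw : G u w by move: wNu; rewrite in_closed_nbhd (negPf wu).
have Gvw : G v w by move: wNu; rewrite -eq_nbhd in_closed_nbhd (negPf wv).
have wD := support_vertex_tds supp_w domD.
(* Applied with z = w when [x] is an end of e, and with z = x otherwise. *)
have del_neq (x y z : T) : z \in [set x; y] -> z != u -> z != v ->
    [set x; y] != [set u; v].
  move=> zxy zu zv; apply: contraTneq zxy => ->.
  by rewrite !inE negb_or zu.
(* Deleting e may cost [u] or [v] its dominator, so [w] takes over; any other [x] keeps its own. *)
apply/forallP => x; have [x_uv | ] := boolP (x \in [set u; v]).
  apply/existsP; exists w; apply/and3P; split=> //; last first.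
    by apply: (del_neq _ _ w) => //; exact: set22.
  by move: x_uv; rewrite !inE => /orP[] /eqP ->.
rewrite !inE negb_or => /andP[xu xv].
have /existsP[y /andP[yD Gxy]] := forallP domD x.
apply/existsP; exists y; apply/and3P; split=> //.
by apply: (del_neq _ _ x) => //; exact: set21.
Qed.
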